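(* Fix a positive integer $k$. For $Q\in\mathbb{N}$ let $\mathcal{F}_{Q,\text{odd}}$ be the set of Farey fractions of order $Q$ with odd denominator, and let $N_{Q,\text{odd}}(k)$ be the number of pairs $a/q<a'/q'$ of consecutive elements of $\mathcal{F}_{Q,\text{odd}}$ (both written in lowest terms) with $qa'-aq'=k$. Then, as $Q\to\infty$, \[N_{Q,\text{odd}}(k)=\left(\frac{2Q^2}{\pi^2}\right)\left(\frac{4}{k(k+1)(k+2)}\right)+O(Q\log Q).\]
   Context: For $Q\in\mathbb{N}$, the Farey fractions of order $Q$ are $\mathcal{F}_Q=\{a/q\in\mathbb{Q}: 0\le a/q\le 1,\ 1\le q\le Q,\ \gcd(a,q)=1\}$, and $\mathcal{F}_{Q,\text{odd}}=\{a/q\in\mathcal{F}_Q : q \text{ odd}\}$. ''Consecutive in $\mathcal{F}_{Q,\text{odd}}$'' means no element of $\mathcal{F}_{Q,\text{odd}}$ lies strictly between them. *)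

(* Defs.v *)
From mathcomp Require Import all_boot all_order all_algebra.
From mathcomp Require Import finmap.
From mathcomp Require Import all_classical all_reals all_analysis.
Set Implicit Arguments.
Unset Strict Implicit.
Unset Printing Implicit Defensive.
Import Order.TTheory GRing.Theory Num.Theory.
Import numFieldNormedType.Exports.
Local Open Scope classical_set_scope.
Local Open Scope ring_scope.

(* [numq x] and [denq x] are the numerator and the positive denominator of
   [x : rat] in lowest terms, so no coprimality condition is needed. *)
Definition farey (Q : nat) : set rat :=
  [set x | 0 <= x <= 1 /\ denq x <= Q%:Z].

Definition farey_odd (Q : nat) : set rat :=
  [set x | farey Q x /\ odd `|denq x|%N].

Definition consecutive (A : set rat) (x y : rat) : Prop :=
  [/\ A x, A y, x < y & ~ (exists2 z, A z & x < z < y)].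

Definition farey_odd_pairs (Q k : nat) : set (rat * rat) :=
  [set xy | consecutive (farey_odd Q) xy.1 xy.2 /\
            denq xy.1 * numq xy.2 - numq xy.1 * denq xy.2 = k%:Z].

(* [fset_set] returns the empty set on infinite arguments; this case does not
   arise here, by [finite_farey_odd_pairs] below. *)
Definition N_odd (Q k : nat) : nat := #|` fset_set (farey_odd_pairs Q k)|%fset.

Lemma finite_farey (Q : nat) : finite_set (farey Q).
Proof.
pose f (p : 'I_Q.+1 * 'I_Q.+1) : rat := (p.1 : nat)%:Q / (p.2 : nat)%:Q.
apply: (@sub_finite_set _ _ (f @` setT)); last exact/finite_image/finite_finset.
move=> x [/andP[x0 x1] xQ].
have n0 : 0 <= numq x by rewrite numq_ge0.
have nd : numq x <= denq x.
  by rewrite -[x]divq_num_den ler_pdivrMr ?ltr0z ?denq_gt0// mul1r ler_int in x1.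
have dQ : (`|denq x| < Q.+1)%N by rewrite ltnS -lez_nat absz_denq.
have nQ : (`|numq x| < Q.+1)%N.
  by rewrite ltnS -lez_nat gez0_abs// (le_trans nd).
exists (Ordinal nQ, Ordinal dQ) => //.
by rewrite /f /= absz_denq gez0_abs// divq_num_den.
Qed.

Lemma finite_farey_odd_pairs (Q k : nat) : finite_set (farey_odd_pairs Q k).
Proof.
apply: (@sub_finite_set _ _ (farey Q `*` farey Q)).
  by move=> [x y] [[[? _] [? _] _ _] _].
by apply: finite_setX; exact: finite_farey.
Qed.

(* Main.v *)
Require Import Defs.
From mathcomp Require Import all_boot all_order all_algebra.
From mathcomp Require Import all_classical all_reals all_analysis.
From mathcomp Require Import zify ring lra.
Import Order.TTheory GRing.Theory Num.Theory.
Import numFieldNormedType.Exports.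
Local Open Scope classical_set_scope.
Local Open Scope ring_scope.

(** Two odd-denominator neighbours in [F_Q] either are adjacent in [F_Q], or have
    exactly one (even-denominator) element of [F_Q] between them, and their
    determinant is then the index [(Q + q) %/ e], where [e] is that even
    denominator and [q] the left one. So pairs of determinant [k] correspond to
    coprime pairs [(q, e)] with [q] odd in an explicit region of the square of
    side [Q], which is a difference of two triangles (up to the parity
    conditions). These triangles are stable under common divisors ([d] scales
    [Q] to [Q %/ d]), so Moebius inversion reduces the count to lattice points
    without coprimality condition, counted up to [O(Q / d)], and to the sum of
    [mu d / d ^ 2] over odd [d]. The latter is [8 / pi ^ 2 + O(log Q / Q)],
    because its convolution with the sum of [1 / m ^ 2] over odd [m] is exactly
    [1], and that last sum is [pi ^ 2 / 8] with an effective error, by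
    comparison with the sum of [1 / sin ^ 2]. *)

(** * Moebius inversion *)

Definition mobius (n : nat) : int :=
  if all (fun p => logn p n == 1%N) (primes n) then (-1) ^+ size (primes n)
  else 0.

Lemma normr_mobius_le1 n : `|mobius n| <= 1.
Proof. by rewrite /mobius; case: ifP; rewrite ?normr0 // normrX normrN1 expr1n. Qed.

Lemma mobius_sqr_dvd p d : prime p -> (0 < d)%N -> (p %| d)%N ->
  mobius (p * d) = 0.
Proof.
move=> p_pr d_gt0 pd; rewrite /mobius; case: ifP => // /allP/(_ p).
have p_gt0 := prime_gt0 p_pr.
rewrite mem_primes p_pr muln_gt0 p_gt0 d_gt0 dvdn_mulr// => /(_ isT)/eqP.
rewrite lognM// logn_prime// eqxx add1n => -[/eqP].
by rewrite -leqn0 leqNgt logn_gt0 mem_primes p_pr d_gt0 pd.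
Qed.

Lemma mobius_primeM p d : prime p -> (0 < d)%N -> ~~ (p %| d)%N ->
  mobius (p * d) = - mobius d.
Proof.
move=> p_pr d_gt0 pd; have p_gt0 := prime_gt0 p_pr.
have perm : perm_eq (primes (p * d)) (p :: primes d).
  apply: uniq_perm; rewrite /= ?primes_uniq ?andbT//.
    by rewrite mem_primes p_pr d_gt0.
  by move=> q; rewrite primesM// primes_prime// inE in_cons.
rewrite /mobius (perm_size perm) (perm_all _ perm) /= lognM// logn_prime// eqxx.
have -> : logn p d = 0%N.
  by apply/eqP; rewrite -leqn0 leqNgt logn_gt0 mem_primes p_pr d_gt0.
rewrite /= (@eq_in_all _ _ (fun q => logn q d == 1%N)); last first.
  move=> q; rewrite mem_primes => /and3P[q_pr _ qd]; rewrite lognM// logn_prime//.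
  case: (eqVneq q p) => // E; move: pd qd; rewrite E => /negP pd qd; case: (pd qd).
by case: ifP => _; rewrite ?exprS ?mulN1r ?oppr0.
Qed.

(** With [p] a prime factor of [n], the divisors [p * e] with [p] dividing [e] contribute 0, and the
    other multiples [p * e] of [p] cancel against the divisors [e] prime to [p]. *)
Lemma sum_mobius_divisors n : (0 < n)%N ->
  \sum_(d <- divisors n) mobius d = (n == 1%N)%:R.
Proof.
move=> n_gt0; have [->|n1] := eqVneq; first by rewrite big_seq1.
set p := pdiv n; have p_pr : prime p by apply: pdiv_prime; lia.
have p_gt0 := prime_gt0 p_pr.
rewrite (bigID (fun d => p %| d)%N) /= (bigID (fun d => p %| d %/ p)%N) /=.
rewrite big_seq_cond big1 ?add0r; last first.
  move=> d /and3P[]; rewrite -dvdn_divisors// => dn /dvdnP[e de].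
  rewrite de mulnK// => pe; rewrite mulnC mobius_sqr_dvd//.
  by have := dvdn_gt0 n_gt0 dn; rewrite de muln_gt0 => /andP[].
rewrite -big_filter.
rewrite (perm_big (map (muln p) [seq d <- divisors n | ~~ (p %| d)%N])) /=.
  rewrite big_map big_filter -big_split big_seq_cond big1 //= => d.
  rewrite -dvdn_divisors// => /andP[dn pd].
  by rewrite mobius_primeM ?addNr// (dvdn_gt0 n_gt0 dn).
apply: uniq_perm.
- by rewrite filter_uniq// divisors_uniq.
- rewrite map_inj_uniq ?filter_uniq ?divisors_uniq//.
  by move=> x y /eqP; rewrite eqn_pmul2l// => /eqP.
move=> x; apply/idP/mapP => [|[d]].
  rewrite mem_filter -dvdn_divisors// => /andP[/andP[/dvdnP[e xe]]].
  rewrite xe mulnK// => pe xn; exists e; rewrite 1?mulnC//.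
  rewrite mem_filter pe -dvdn_divisors//; apply: dvdn_trans xn.
  exact: dvdn_mulr.
rewrite mem_filter -dvdn_divisors// => /andP[pd dn] ->.
rewrite mem_filter -dvdn_divisors// dvdn_mulr// mulKn// pd /=.
by rewrite Gauss_dvd ?pdiv_dvd ?dn// prime_coprime.
Qed.

(** The range of [d] no longer depends on [n], so that sums over [d] and over [n] can be
    exchanged. *)
Lemma sum_mobius N n : (0 < n <= N)%N ->
  \sum_(1 <= d < N.+1 | (d %| n)%N) mobius d = (n == 1%N)%:R.
Proof.
move=> /andP[n_gt0 nN]; rewrite -sum_mobius_divisors// -big_filter.
apply: perm_big; apply: uniq_perm; rewrite ?divisors_uniq ?filter_uniq ?iota_uniq//.
move=> d; rewrite mem_filter mem_index_iota -dvdn_divisors//.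
by case: (boolP (d %| n)%N) => //= dn; have := dvdn_leq n_gt0 dn;
  have := dvdn_gt0 n_gt0 dn; lia.
Qed.

Lemma big_dvdn_nat (V : nmodType) N d (f : nat -> V) : (0 < d)%N ->
  \sum_(0 <= x < N.+1 | (d %| x)%N) f x =
  \sum_(0 <= x < (N %/ d).+1) f (d * x)%N.
Proof.
move=> d_gt0; rewrite -[RHS](big_map (muln d) xpredT) -[LHS]big_filter; apply: perm_big.
apply: uniq_perm; rewrite ?filter_uniq ?iota_uniq//.
  rewrite map_inj_uniq ?iota_uniq//.
  by move=> x y /eqP; rewrite eqn_pmul2l// => /eqP.
move=> x; rewrite mem_filter mem_index_iota; apply/idP/mapP => [|[y]].
  move=> /andP[/dvdnP[y ->]]; rewrite ltnS -leq_divRL// => yN.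
  by exists y; rewrite ?mem_index_iota 1?mulnC.
by rewrite mem_index_iota /= ltnS leq_divRL// => yN ->; rewrite dvdn_mulr//= ltnS mulnC.
Qed.

(* Coprime pairs with [far n k x y] are the denominators of the neighbours
   [a/x < b/y] in F_n with [x] odd for which the successor of [a/x] among the
   odd-denominator fractions is at determinant at least [k]. *)
Definition far (n k x y : nat) : bool :=
  [&& odd x, x <= n, y <= n, n < x + y &
      (k == 1) || ~~ odd y && (k * y <= n + x)]%N.

(** Every inequality compares a multiple of [d] with [Q], hence is equivalent to one with [Q %/ d].
    An even [d] is excluded by the oddness of [d * x], and an odd one preserves parities. *)
Lemma farM Q k d x y : (0 < d)%N ->
  far Q k (d * x) (d * y) = odd d && far (Q %/ d) k x y.
Proof.
move=> d_gt0; rewrite /far !oddM.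
case: (odd d) => //=; rewrite -mulnDr.
(* Moving [d * x] to the left, with truncated subtraction, leaves a multiple of [d] compared with
   [Q]. *)
have -> : (k * (d * y) <= Q + d * x)%N = (k * y <= Q %/ d + x)%N.
  by rewrite mulnCA addnC -leq_subLR -mulnBr [(Q %/ d + x)%N]addnC -leq_subLR leq_divRL// mulnC.
by rewrite !leq_divRL// ltn_divLR// ![(_ * d)%N]mulnC.
Qed.

Definition nfar (n k : nat) : nat :=
  \sum_(0 <= x < n.+1) \sum_(0 <= y < n.+1) far n k x y.

Definition nfar_coprime (n k : nat) : nat :=
  \sum_(0 <= x < n.+1) \sum_(0 <= y < n.+1) (far n k x y && coprime x y).

Lemma nfar_coprimeE Q k : (nfar_coprime Q k)%:R =
  \sum_(1 <= d < Q.+1 | odd d) mobius d * (nfar (Q %/ d) k)%:R :> int.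
Proof.
transitivity (\sum_(0 <= x < Q.+1) \sum_(0 <= y < Q.+1) \sum_(1 <= d < Q.+1)
    (if (d %| x)%N then if (d %| y)%N then mobius d * (far Q k x y)%:R else 0 else 0)).
  rewrite /nfar_coprime natr_sum; apply: eq_bigr => x _.
  rewrite natr_sum; apply: eq_bigr => y _.
  case: (boolP (far Q k x y)) => [Pxy|_] /=; last first.
    by rewrite big1// => d _; rewrite mulr0 !if_same.
  transitivity (\sum_(1 <= d < Q.+1 | (d %| gcdn x y)%N) mobius d).
    rewrite sum_mobius//; case/and5P: Pxy => + + _ _ _; case: x => // x _ xQ.
    by rewrite gcdn_gt0/= (leq_trans (dvdn_leq _ (dvdn_gcdl _ _))).
  rewrite big_mkcond; apply: eq_bigr => d _; rewrite dvdn_gcd mulr1.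
  by case: (d %| x)%N.
under eq_bigr do rewrite exchange_big.
rewrite exchange_big [RHS]big_mkcond; apply: eq_big_nat => d /andP[d_gt0 _].
transitivity (\sum_(0 <= x < Q.+1 | (d %| x)%N)
    \sum_(0 <= y < Q.+1 | (d %| y)%N) mobius d * (far Q k x y)%:R).
  rewrite [RHS]big_mkcond; apply: eq_bigr => x _.
  by case: ifP => _; [rewrite [RHS]big_mkcond | rewrite big1].
rewrite big_dvdn_nat// (eq_bigr (fun x => \sum_(0 <= y < (Q %/ d).+1)
    mobius d * (odd d && far (Q %/ d) k x y)%:R)); last first.
  by move=> x _; rewrite big_dvdn_nat//; apply: eq_bigr => y _; rewrite farM.
case: (odd d) => /=; last by rewrite big1// => x _; rewrite big1// => y _; rewrite mulr0.
rewrite natr_sum mulr_sumr; apply: eq_bigr => x _.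
by rewrite natr_sum mulr_sumr.
Qed.

(** * Lattice points in a triangle *)

Lemma sum_odd_nat (V : nmodType) n (f : nat -> V) :
  \sum_(0 <= x < n.+1 | odd x) f x = \sum_(0 <= t < uphalf n) f t.*2.+1.
Proof.
elim: n => [|n IH]; first by rewrite big_mkcond big_nat1 big_geq.
rewrite big_mkcond big_nat_recr// -big_mkcond IH /= uphalf_half.
case: (boolP (odd n)) => /= on; rewrite ?addr0 ?uphalf_half ?on//.
by rewrite add0n big_nat_recr//= even_halfK.
Qed.

Lemma count_even a b N :
  (\sum_(0 <= y < N.+1) (~~ odd y && (a < y <= b)) = (minn b N)./2 - a./2)%N.
Proof.
elim: N => [|N IH]; first by rewrite big_nat1 minn0 /=; lia.
by rewrite big_nat_recr //= IH; lia.
Qed.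

(** For [k = 1] there is no parity condition on [y], so each odd [x] is paired with the [x] values
    of [y] from [n - x + 1] to [n]; the first odd numbers sum to a square. *)
Lemma nfar1 n : nfar n 1 = ((uphalf n) ^ 2)%N.
Proof.
have -> : nfar n 1 = (\sum_(0 <= x < n.+1 | odd x) x)%N.
  rewrite [RHS]big_mkcond; apply: eq_big_nat => x /andP[_ xn].
  rewrite /far /=; case: (odd x); last by rewrite big1.
  transitivity (\sum_(0 <= y < n.+1) (n - x < y)%N)%N.
    by apply: eq_big_nat => y /andP[_ yn]; congr nat_of_bool; lia.
  rewrite /= (big_cat_nat (n := (n - x).+1)) ?ltnS ?leq_subr//=.
  rewrite big_nat big1 ?add0n; last by move=> y; lia.
  rewrite (eq_big_nat _ _ (F2 := fun=> 1%N)); last by move=> y; lia.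
  by rewrite sum_nat_const_nat; lia.
rewrite sum_odd_nat; elim: (uphalf n) => [|m IH]; first by rewrite big_geq.
by rewrite big_nat_recr//= IH; lia.
Qed.

(* For [w] the largest odd number up to [n], the [t]-th term counts the even [y]
   such that [far n k (w - 2 t) y]. *)
Definition wedge (k w N : nat) : nat := \sum_(0 <= t < N) ((w - t) %/ k - t)%N.

(** For odd [x], the even [y] lie above [n - x] and up to [(n + x) %/ k]. With [x = w - 2 t], half
    of [n + x] is [w - t] and half of [n - x] is [t], whatever the parity of [n]. *)
Lemma nfarE n k : (1 < k)%N -> nfar n k = wedge k (n - ~~ odd n)%N (uphalf n).
Proof.
move=> k1; have k0 := ltnW k1; rewrite /wedge /nfar.
transitivity (\sum_(0 <= x < n.+1 | odd x) (((n + x) %/ k)./2 - (n - x)./2))%N.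
  rewrite [RHS]big_mkcond; apply: eq_big_nat => x /andP[_ xn].
  rewrite /far /=; case: (odd x); last by rewrite big1.
  transitivity (\sum_(0 <= y < n.+1)
      (~~ odd y && (n - x < y <= (n + x) %/ k)))%N.
    apply: eq_big_nat => y /andP[_ yn]; congr nat_of_bool => /=.
    rewrite leq_divRL// [(y * k)%N]mulnC; lia.
  (* Here [1 < k] gives [(n + x) %/ k <= n], so the range of [y] does not truncate the count. *)
  rewrite count_even (minn_idPl _)//.
  by rewrite -ltnS ltn_divLR //; nia.
rewrite sum_odd_nat big_nat_rev; apply: eq_big_nat => t /andP[_ tn].
have xE : (n - (0 + uphalf n - t.+1).*2.+1 = t.*2 + ~~ odd n)%N by lia.
rewrite xE -divn2 -divnMA mulnC divnMA divn2.
congr (_ %/ _ - _)%N; lia.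
Qed.

(** Raising [w] by [k + 1] and [t] by 1 raises both the quotient and the subtracted index by 1, so
    only the new term at [t = 0] changes the sum. *)
Lemma wedgeS k w N : (0 < k)%N ->
  wedge k (w + k.+1) N.+1 = ((w + k.+1) %/ k + wedge k w N)%N.
Proof.
move=> k0; rewrite /wedge big_nat_recl// !subn0; congr addn.
apply: eq_big_nat => t _; have [tw|wt] := leqP t w.
  have -> : (w + k.+1 - t.+1 = 1 * k + (w - t))%N by lia.
  by rewrite divnMDl//; lia.
by rewrite (@divn_small (_ - _)) ?(@divn_small (w - t)); lia.
Qed.

(** Induction in steps of [k + 1] on [w], along [wedgeS]: each step adds about [(w + k + 1) / k],
    which is the increment of [w ^ 2 / (2 k (k + 1))] up to a bounded amount. The bound on [w]
    ensures that no nonzero term is cut off. *)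
Lemma wedge_bounds k w N : (0 < k)%N -> (w <= k.+1 * N)%N ->
  (w ^ 2 <= 2 * k * k.+1 * wedge k w N + 2 * k * w)%N /\
  (2 * k * k.+1 * wedge k w N <= (w + k.+1) ^ 2)%N.
Proof.
move=> k0; elim: N w => [|N IH] w wN.
  have -> : w = 0%N by lia.
  by rewrite /wedge big_geq// !muln0.
have [kw|wk] := leqP k.+1 w.
  move: wN; rewrite -(subnK kw); set v := (w - _)%N => wN.
  have [|lo up] := IH v; first by lia.
  rewrite wedgeS//; set q := ((_ + _) %/ k)%N.
  have qlo : (k * q <= v + k.+1)%N by rewrite mulnC leq_divM.
  have qup : (v + k.+1 < k * q + k)%N by rewrite -mulnSr mulnC -ltn_divLR.
  move: (wedge k v N) lo up => H lo up; clearbody q v; clear IH kw wN.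
  move: qlo qup; rewrite !mulnDr; set p := (2 * k * k.+1 * q)%N => qlo qup.
  have plo : (p <= 2 * k.+1 * (v + k.+1))%N by rewrite /p; nia.
  have pup : (2 * k.+1 * (v + k.+1) < p + 2 * k.+1 * k)%N by rewrite /p; nia.
  by split; nia.
have -> : wedge k w N.+1 = (w %/ k)%N.
  rewrite /wedge big_nat_recl// big1_seq ?subn0 ?addn0// => t _.
  by rewrite divn_small; lia.
have := leq_divM w k; set q := (w %/ k)%N; clearbody q => qk.
by split; nia.
Qed.

(** The constant [k.+1 * (k + 3)] is [2 (k + 1) + (k + 1) ^ 2], from expanding [(n + k + 1) ^ 2] and
    using [1 <= n]. *)
Lemma nfar_bounds n k : (0 < k)%N -> (0 < n)%N ->
  (n ^ 2 <= 2 * k * k.+1 * nfar n k + 2 * k.+1 * n)%N /\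
  (2 * k * k.+1 * nfar n k <= n ^ 2 + k.+1 * (k + 3) * n)%N.
Proof.
move=> k0 n0; have [->|k1] := eqVneq k 1%N.
  rewrite nfar1; have : (n <= 2 * uphalf n <= n.+1)%N by lia.
  move/andP => [lo up]; move: (uphalf n) lo up => u lo up.
  split.
    nia.
  nia.
rewrite nfarE; last by lia.
set w := (n - _)%N; have wn : (w <= n <= w.+1)%N by rewrite /w; lia.
have [||] := @wedge_bounds k w (uphalf n) => //; first by rewrite /w; nia.
move: (wedge _ _ _) => H; clearbody w; case/andP: wn => wn nw lo up.
by split; nia.
Qed.

(** After division by [2 k (k + 1)] the errors are [n / k] and [(k + 3) n / (2 k)], both at most
    [2 n], uniformly in [k]. *)
Lemma nfar_approx (R : realFieldType) n k : (0 < k)%N -> (0 < n)%N ->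
  `|(nfar n k)%:R - n%:R ^+ 2 / (2 * k%:R * (k%:R + 1))| <= 2 * n%:R :> R.
Proof.
move=> k0 n0; have [lo up] := @nfar_bounds n k k0 n0.
have kp : 1 <= k%:R :> R by rewrite ler1n.
have np : 0 <= n%:R :> R by [].
have {}lo : n%:R ^+ 2 <= 2 * k%:R * (k%:R + 1) * (nfar n k)%:R
    + 2 * (k%:R + 1) * n%:R :> R.
  by move: lo; rewrite -(ler_nat R); congr (_ <= _); ring.
have {}up : 2 * k%:R * (k%:R + 1) * (nfar n k)%:R
    <= n%:R ^+ 2 + (k%:R + 1) * (k%:R + 3) * n%:R :> R.
  by move: up; rewrite -(ler_nat R); congr (_ <= _); ring.
move: (nfar n k)%:R n%:R k%:R np kp lo up => F x y x0 y1 lo up.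
have y0 : 0 < 2 * y * (y + 1) by nra.
rewrite -(ler_pM2r y0) -[X in _ * X <= _](gtr0_norm y0) -normrM mulrBl divfK ?gt_eqF//.
by rewrite ler_norml; apply/andP; split; nra.
Qed.

(** * The sum of inverse odd squares *)

Section trigo_bounds.
Context {R : realType}.
Implicit Types x y : R.

Lemma is_derive_ge0_le (f df : R -> R) x : 0 <= x ->
  (forall y, y \in `[0, x] -> is_derive y 1 f (df y)) ->
  (forall y, y \in `[0, x] -> 0 <= df y) -> f 0 <= f x.
Proof.
move=> x0 fd df0; have [->//|xn0] := eqVneq x 0.
have xp : 0 < x by rewrite lt_neqAle eq_sym xn0.
have fd' y : y \in `]0, x[ -> is_derive y 1 f (df y).
  by move=> yin; apply: fd; apply: subset_itv_oo_cc yin.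
have cf : {within `[0, x], continuous f}.
  by apply: derivable_within_continuous => y yin; have := fd y yin => -[].
have [c cin] := MVT xp fd' cf.
rewrite -subr_ge0 => ->; rewrite subr0 mulr_ge0// df0//.
exact: subset_itv_oo_cc cin.
Qed.

Lemma sin_le x : 0 <= x -> sin x <= x.
Proof.
move=> x0; rewrite -subr_ge0.
have := @is_derive_ge0_le (fun y => y - sin y) (fun y => 1 - cos y) x x0.
rewrite sin0 subr0; by apply => y _; rewrite subr_ge0 cos_le1.
Qed.

Lemma le_tan x : 0 <= x < pi / 2 -> x <= tan x.
Proof.
move=> /andP[x0 xpi]; rewrite -subr_ge0.
have cosy y : y \in `[0, x] -> 0 < cos y.
  rewrite in_itv/= => /andP[y0 yx]; apply: cos_gt0_pihalf.
  rewrite (le_lt_trans yx xpi) andbT (lt_le_trans _ y0)// oppr_lt0 divr_gt0//.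
  exact: pi_gt0.
have := @is_derive_ge0_le (fun y => tan y - y) (fun y => (cos y) ^- 2 - 1) x x0.
rewrite tan0 subr0; apply => y /cosy cy.
  by apply: is_deriveB; apply: is_derive_tan; rewrite gt_eqF.
rewrite subr_ge0 invf_ge1 ?exprn_gt0// -[leRHS](expr1n _ 2) ler_sqr ?nnegrE ?cos_le1//.
Qed.

(** This is [sin x <= x <= tan x], together with [1 / tan ^ 2 = 1 / sin ^ 2 - 1]. *)
Lemma invr_sqr_bounds x : 0 < x < pi / 2 ->
  (sin x) ^- 2 - 1 <= x ^- 2 <= (sin x) ^- 2.
Proof.
move=> /andP[x0 xpi]; have s0 : 0 < sin x by apply: sin_gt0_pihalf; rewrite x0.
have c0 : 0 < cos x.
  by apply: cos_gt0_pihalf; rewrite xpi (lt_trans _ x0)// oppr_lt0 divr_gt0// pi_gt0.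
apply/andP; split; last first.
  by rewrite lef_pV2 ?posrE ?exprn_gt0// ler_sqr ?nnegrE ?(ltW x0) ?(ltW s0)// sin_le// ltW.
have -> : (sin x) ^- 2 - 1 = (tan x) ^- 2.
  rewrite /tan expr_div_n invf_div cos2sin2.
  by field; rewrite gt_eqF.
have t0 : 0 < tan x by rewrite divr_gt0.
by rewrite lef_pV2 ?posrE ?exprn_gt0// ler_sqr ?nnegrE ?(ltW x0) ?(ltW t0)// le_tan// ltW.
Qed.

Lemma sin2V_double y : sin y != 0 -> cos y != 0 ->
  (sin (y *+ 2)) ^- 2 = ((sin y) ^- 2 + (cos y) ^- 2) / 4.
Proof.
move=> sy cy; have := cos2Dsin2 y; rewrite sin_mulr2n.
set s := sin y in sy *; set c := cos y in cy * => e.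
have -> : (c * s) *+ 2 = 2 * c * s by rewrite -mulr_natl mulrA.
have -> : s ^- 2 + c ^- 2 = (c ^+ 2 + s ^+ 2) / (c ^+ 2 * s ^+ 2).
  by field; rewrite sy cy.
by rewrite e; field; rewrite sy cy.
Qed.

End trigo_bounds.

Section basel.
Context {R : realType}.

(** For [j < N] these are the odd multiples of [pi / (4 N)] in the first quadrant; their inverse
    squares are those of the odd numbers up to a common factor. *)
Definition odd_angle (N j : nat) : R := j.*2.+1%:R / (4 * N%:R) * pi.

Lemma odd_angle_itv N j : (j < N)%N -> 0 < odd_angle N j < pi / 2.
Proof.
move=> jN; have N0 : 0 < N%:R :> R by rewrite ltr0n (leq_ltn_trans _ jN).
have p0 := @pi_gt0 R; rewrite /odd_angle mulr_gt0 ?divr_gt0 ?mulr_gt0//=.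
rewrite mulrC ltr_pM2l// ltr_pdivrMr ?mulr_gt0//.
have -> : 2^-1 * (4 * N%:R) = (2 * N)%:R :> R by rewrite natrM; field.
by rewrite ltr_nat; lia.
Qed.

(* Since [cos y = sin (pi / 2 - y)], pairing opposite angles at level [2 N] gives
   4 times the sum at level [N], by [sin2V_double]. *)
Lemma sum_sin2V m :
  \sum_(0 <= j < 2 ^ m) (sin (odd_angle (2 ^ m) j)) ^- 2 = 2 * (2 ^ m)%:R ^+ 2 :> R.
Proof.
have sc N j : (j < N)%N -> 0 < sin (odd_angle N j) /\ 0 < cos (odd_angle N j).
  move=> /odd_angle_itv/andP[x0 xp]; split; first by rewrite sin_gt0_pihalf ?x0.
  by rewrite cos_gt0_pihalf// xp (lt_trans _ x0)// oppr_lt0 divr_gt0// pi_gt0.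
have cosE N j : (j < N)%N ->
    cos (odd_angle N j) = sin (odd_angle N (N - j.+1)).
  move=> jN; rewrite -cosBpihalf -cosN; congr cos.
  rewrite /odd_angle; have -> : (N - j.+1).*2.+1 = (2 * N - j.*2.+1)%N by lia.
  rewrite natrB; last by lia.
  rewrite natrM; have N0 : N%:R != 0 :> R by rewrite pnatr_eq0; lia.
  by field.
elim: m => [|m IH].
  (* At level 1 the angle is [pi / 4], where sine and cosine agree, so doubling it to [pi / 2]
     determines the value. *)
  rewrite expn0 big_nat1; have [s0 c0] := sc 1%N 0%N isT.
  have := sin2V_double _ (lt0r_neq0 s0) (lt0r_neq0 c0).
  rewrite (cosE 1%N 0%N)// subnn; have -> : odd_angle 1 0 *+ 2 = pi / 2.
    by rewrite /odd_angle -mulr_natl; field.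
  rewrite sin_pihalf expr1n invr1 mulr1 => e; lra.
set N := (2 ^ m)%N in IH *; have N0 : (0 < N)%N by rewrite expn_gt0.
rewrite expnS mul2n -/N.
rewrite (@big_cat_nat _ _ _ N) //=; last by lia.
rewrite [X in _ + X](_ : _ = \sum_(0 <= j < N) (cos (odd_angle N.*2 j)) ^- 2).
  rewrite -big_split (eq_big_nat _ _ (F2 := fun j => 4 * (sin (odd_angle N j)) ^- 2)).
    by rewrite -mulr_sumr IH -[N.*2]mul2n natrM; ring.
  move=> j jN /=; have jN2 : (j < N.*2)%N by lia.
  have [s0 c0] := sc _ _ jN2.
  have -> : odd_angle N j = odd_angle N.*2 j *+ 2.
    rewrite /odd_angle -[RHS]mulr_natl -[N.*2]mul2n [(2 * N)%:R]natrM.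
    by field; rewrite pnatr_eq0 -lt0n.
  by rewrite sin2V_double ?lt0r_neq0//; lra.
rewrite [RHS]big_nat_rev -{1}[N]add0n -addnn big_addn addnK.
apply: eq_big_nat => j jN; rewrite cosE; last by lia.
by rewrite addnn; congr ((sin (odd_angle _ _)) ^- 2); lia.
Qed.

(** Summing [invr_sqr_bounds] over the angles, the lower bound loses 1 for each of the [2 ^ m]
    terms, against a total of [2 (2 ^ m) ^ 2]. *)
Lemma sum_odd_sqrV_pow2 m (S : R := \sum_(0 <= j < 2 ^ m) j.*2.+1%:R ^- 2) :
  (2 ^ m)%:R * (pi ^+ 2 / 8) - pi ^+ 2 / 16 <= (2 ^ m)%:R * S <= (2 ^ m)%:R * (pi ^+ 2 / 8).
Proof.
rewrite {}/S; have := sum_sin2V m; set N := (2 ^ m)%N => sumE.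
have N0 : 0 < N%:R :> R by rewrite ltr0n expn_gt0.
have p0 := @pi_gt0 R.
set S := \sum_(0 <= j < N) _.
have SE : \sum_(0 <= j < N) (odd_angle N j) ^- 2 = 16 * N%:R ^+ 2 / pi ^+ 2 * S.
  rewrite mulr_sumr; apply: eq_bigr => j _; rewrite /odd_angle.
  have j0 : 0 < j.*2.+1%:R :> R by [].
  by move: pi p0 (_%:R) j0 N%:R N0 => p p0 z z0 n n0; field; rewrite !gt_eqF.
have up : 16 * N%:R ^+ 2 / pi ^+ 2 * S <= 2 * N%:R ^+ 2.
  rewrite -SE -sumE; apply: ler_sum_nat => j /andP[_ jN].
  by have /andP[] := invr_sqr_bounds _ (odd_angle_itv _ _ jN).
have lo : 2 * N%:R ^+ 2 - N%:R <= 16 * N%:R ^+ 2 / pi ^+ 2 * S.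
  rewrite -SE -sumE -[X in _ - X](_ : \sum_(0 <= j < N) 1 = _); last first.
    by rewrite sumr_const_nat subn0.
  rewrite -sumrB; apply: ler_sum_nat => j /andP[_ jN].
  by have /andP[] := invr_sqr_bounds _ (odd_angle_itv _ _ jN).
have SN : N%:R * S = (16 * N%:R ^+ 2 / pi ^+ 2 * S) * (pi ^+ 2 / (16 * N%:R)).
  by move: pi p0 N%:R N0 {SE up lo sumE} S => p p0 n n0 z; field; rewrite !gt_eqF.
have q0 : 0 <= pi ^+ 2 / (16 * N%:R) :> R by rewrite divr_ge0 ?exprn_ge0 ?mulr_ge0 ?ltW.
rewrite SN; apply/andP; split.
  apply: le_trans (ler_wpM2r q0 lo); rewrite le_eqVlt; apply/orP; left; apply/eqP.
  by move: pi p0 N%:R N0 {SN q0} => p p0 n n0; field; rewrite !gt_eqF.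
apply: (le_trans (ler_wpM2r q0 up)); rewrite le_eqVlt; apply/orP; left; apply/eqP.
by move: pi p0 N%:R N0 {SN q0} => p p0 n n0; field; rewrite !gt_eqF.
Qed.

(** The partial sums increase, so the bounds at the powers of 2 around [N] suffice: the upper one
    has no error, and the lower one uses [N <= 2 * 2 ^ m]. *)
Lemma sum_odd_sqrV N : (0 < N)%N ->
  `|\sum_(0 <= j < N) j.*2.+1%:R ^- 2 - pi ^+ 2 / 8| <= pi ^+ 2 / (8 * N%:R) :> R.
Proof.
move=> N0; pose S n : R := \sum_(0 <= j < n) j.*2.+1%:R ^- 2; rewrite -/(S N).
have S_le i n : (i <= n)%N -> S i <= S n.
  move=> le_in; rewrite /S (big_cat_nat (n := i) (p := n))//= lerDl; apply: sumr_ge0 => j _.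
  by rewrite invr_ge0 exprn_ge0.
have /andP[le_m lt_m] := trunc_log_bounds (isT : (1 < 2)%N) N0.
set m := trunc_log 2 N in le_m lt_m.
have /andP[lo _] := sum_odd_sqrV_pow2 m; have /andP[_ up] := sum_odd_sqrV_pow2 m.+1.
have up' : S N <= pi ^+ 2 / 8.
  apply: le_trans (S_le _ _ (ltnW lt_m)) _.
  by move: up; rewrite ler_pM2l// ltr0n expn_gt0.
have P0 : 0 < (2 ^ m)%:R :> R by rewrite ltr0n expn_gt0.
have PN : N%:R <= 2 * (2 ^ m)%:R :> R by rewrite -natrM ler_nat -expnS ltnW.
have NR : 0 < N%:R :> R by rewrite ltr0n.
have p0 : 0 <= pi ^+ 2 :> R by rewrite exprn_ge0// pi_ge0.
have lo' : pi ^+ 2 / 8 - pi ^+ 2 / (8 * N%:R) <= S N.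
  apply: le_trans (S_le _ _ le_m); rewrite -(ler_pM2l P0); apply: le_trans lo.
  rewrite mulrBr lerD2l lerN2 mulrCA ler_wpM2l//.
  by rewrite ler_pdivlMr ?mulr_gt0//; lra.
rewrite ler_norml; apply/andP; split; first by lra.
have : 0 <= pi ^+ 2 / (8 * N%:R) :> R by rewrite divr_ge0// mulr_ge0// ltW.
by lra.
Qed.
End basel.

(** * The Moebius sum over odd divisors *)

Section mobius_sums.
Context {R : realType}.

Definition harmonic_sum (N : nat) : R := \sum_(1 <= d < N.+1) d%:R^-1.

Lemma harmonic_sum_le N : (0 < N)%N -> harmonic_sum N <= 1 + ln N%:R.
Proof.
rewrite /harmonic_sum; elim: N => // -[|N] IH _.
  by rewrite big_nat1 ln1 invr1 addr0.
rewrite big_nat_recr//=; apply: le_trans (lerD (IH isT) (lexx _)) _.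
have n0 : 0 < N.+1%:R :> R by [].
have m0 : 0 < N.+2%:R :> R by [].
rewrite -addrA lerD2l -lerBrDl -ln_div ?posrE//.
rewrite -[leRHS]opprK -lnV ?posrE ?divr_gt0// invf_div lerNr.
have -> : N.+1%:R / N.+2%:R = 1 + - N.+2%:R^-1 :> R.
  have m0' := lt0r_neq0 m0.
  by apply: (mulIf m0'); rewrite mulrBl divfK// mulVf// mul1r -[N.+2%:R]natr1 addrK.
apply: le_ln1Dx; rewrite ltrN2 invf_lt1// ltr1n.
by [].
Qed.

Definition odd_sqrV (N : nat) : R := \sum_(0 <= m < N.+1 | odd m) m%:R ^- 2.

Lemma odd_sqrV_approx N : (0 < N)%N ->
  `|odd_sqrV N - pi ^+ 2 / 8| <= pi ^+ 2 / (4 * N%:R).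
Proof.
move=> N0; rewrite /odd_sqrV sum_odd_nat.
have u0 : (0 < uphalf N)%N by lia.
apply: le_trans (sum_odd_sqrV _ u0) _; rewrite ler_wpM2l ?exprn_ge0 ?pi_ge0//.
rewrite lef_pV2 ?posrE ?mulr_gt0 ?ltr0n// -!natrM ler_nat; lia.
Qed.

Definition odd_mobius_sum (N : nat) : R :=
  \sum_(1 <= d < N.+1 | odd d) (mobius d)%:~R / d%:R ^+ 2.

(** Grouping by [n = d * m], with [n] odd and at most [N], the inner sum of [mobius] keeps only
    [n = 1]; the truncation at [N %/ d] makes the identity exact. *)
Lemma odd_mobius_sumM N : (0 < N)%N ->
  \sum_(1 <= d < N.+1 | odd d) (mobius d)%:~R / d%:R ^+ 2 * odd_sqrV (N %/ d) = 1.
Proof.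
move=> N0.
transitivity (\sum_(0 <= n < N.+1) \sum_(1 <= d < N.+1)
   if (d %| n)%N then (odd n)%:R * n%:R ^- 2 * (mobius d)%:~R else 0 : R).
  rewrite exchange_big [LHS]big_mkcond; apply: eq_big_nat => d /andP[d0 _].
  rewrite -big_mkcond big_dvdn_nat//.
  case: (boolP (odd d)) => od; last first.
    by rewrite big1// => n _; rewrite oddM (negbTE od) /= !mul0r.
  rewrite /odd_sqrV mulr_sumr [LHS]big_mkcond; apply: eq_bigr => n _.
  rewrite oddM od /=; case: (odd n); rewrite ?mul0r// mul1r natrM exprMn.
  by rewrite -mulrA -invfM [RHS]mulrC.
transitivity (\sum_(0 <= n < N.+1) ((n == 1%N)%:R : R)); last first.
  rewrite (big_cat_nat (n := 2))//= big_ltn// big_nat1/= add0r big_nat big1 ?addr0//.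
  by case=> [|[|n]].
(* [sum_mobius] requires a positive [n]; the term at 0 vanishes because 0 is even. *)
apply: eq_big_nat => -[|n] /andP[_ nN].
  by rewrite big1// => d _; rewrite !mul0r; case: ifP.
rewrite -big_mkcond -mulr_sumr -rmorph_sum sum_mobius//=.
by case: n nN => [|n] _ /=; rewrite ?mulr0// mulr1 expr1n invr1 mulr1.
Qed.

(** Replacing [odd_sqrV (N %/ d)] by [pi ^ 2 / 8] in [odd_mobius_sumM] costs at most
    [pi ^ 2 / (4 d ^ 2 (N %/ d))], hence at most [pi ^ 2 / (2 N d)] since [N <= 2 d (N %/ d)]; the
    sum over [d] is harmonic. *)
Lemma odd_mobius_sum_approx N : (0 < N)%N ->
  `|odd_mobius_sum N - 8 / pi ^+ 2| <= 4 * harmonic_sum N / N%:R.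
Proof.
move=> N0; have p0 : 0 < pi ^+ 2 :> R by rewrite exprn_gt0// pi_gt0.
have NR : 0 < N%:R :> R by rewrite ltr0n.
have -> : odd_mobius_sum N - 8 / pi ^+ 2 =
    - (8 / pi ^+ 2) * (1 - pi ^+ 2 / 8 * odd_mobius_sum N).
  by move: (pi ^+ 2) p0 => p p0; field; rewrite gt_eqF.
have e0 : 0 < 8 / pi ^+ 2 :> R by rewrite divr_gt0.
rewrite normrM normrN (gtr0_norm e0) -ler_pdivlMl//.
rewrite -{1}(odd_mobius_sumM N N0) mulr_sumr -sumrB.
apply: le_trans (ler_norm_sum _ _ _) _.
rewrite big_mkcond.
have -> : (8 / pi ^+ 2)^-1 * (4 * harmonic_sum N / N%:R) =
    \sum_(1 <= d < N.+1) pi ^+ 2 / (2 * N%:R) * d%:R^-1.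
  rewrite -mulr_sumr -/(harmonic_sum N).
  by move: (pi ^+ 2) p0 {e0} => p p0; field; rewrite !gt_eqF.
apply: ler_sum_nat => d /andP[d0]; rewrite ltnS => dN.
have dR : 0 < d%:R :> R by rewrite ltr0n.
case: ifP => _; last by rewrite mulr_ge0 ?divr_ge0 ?(ltW p0)// mulr_ge0.
have q0 : (0 < N %/ d)%N by rewrite divn_gt0.
rewrite [X in _ - X]mulrC -mulrBr normrM normrM.
apply: (@le_trans _ _ (d%:R ^- 2 * (pi ^+ 2 / (4 * (N %/ d)%:R)))).
  rewrite ler_pM ?mulr_ge0// ?odd_sqrV_approx//.
  rewrite [X in _ * X <= _]ger0_norm ?invr_ge0 ?exprn_ge0// ler_piMl ?invr_ge0 ?exprn_ge0//.
  by rewrite -intr_norm lerz1 normr_mobius_le1.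
have qR : 0 < (N %/ d)%:R :> R by rewrite ltr0n.
have Nd : N%:R <= 2 * (d%:R * (N %/ d)%:R) :> R.
  by rewrite -!natrM ler_nat; have := ltn_ceil N d0; nia.
rewrite mulrCA -[leRHS]mulrA ler_pM2l// -!invfM lef_pV2 ?posrE ?mulr_gt0//.
by nra.
Qed.

End mobius_sums.

(** * Asymptotic count of the coprime pairs in the region *)

Section count.
Context {R : realType}.

(** Of the constant 4, 3 comes from replacing lattice counts by areas and 1 from the error of the
    Moebius sum. *)
Lemma nfar_coprime_approx Q k : (0 < k)%N -> (0 < Q)%N ->
  `|(nfar_coprime Q k)%:R - Q%:R ^+ 2 / (2 * k%:R * (k%:R + 1)) * (8 / pi ^+ 2)|
  <= 4 * Q%:R * harmonic_sum Q :> R.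
Proof.
move=> k0 Q0; set c : R := (2 * k%:R * (k%:R + 1))^-1.
have kR : 1 <= k%:R :> R by rewrite ler1n.
have QR : 0 < Q%:R :> R by rewrite ltr0n.
have c0 : 0 < c by rewrite invr_gt0; nra.
have c4 : c <= 4^-1 by rewrite lef_pV2 ?posrE//; nra.
have main : `|(nfar_coprime Q k)%:R - c * Q%:R ^+ 2 * odd_mobius_sum Q|
    <= 3 * Q%:R * harmonic_sum Q :> R.
  have -> : (nfar_coprime Q k)%:R =
      \sum_(1 <= d < Q.+1 | odd d) (mobius d)%:~R * (nfar (Q %/ d) k)%:R :> R.
    transitivity (((nfar_coprime Q k)%:R : int)%:~R : R).
      by rewrite natz -pmulrn.
    rewrite nfar_coprimeE rmorph_sum; apply: eq_bigr => d _.
    by rewrite rmorphM /= natz.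
  rewrite mulr_sumr -sumrB; apply: le_trans (ler_norm_sum _ _ _) _.
  rewrite big_mkcond mulr_sumr; apply: ler_sum_nat => d /andP[d0]; rewrite ltnS => dQ.
  have dR : 0 < d%:R :> R by rewrite ltr0n.
  case: ifP => _; last by rewrite !mulr_ge0.
  have q0 : (0 < Q %/ d)%N by rewrite divn_gt0.
  have := @nfar_approx R (Q %/ d) k k0 q0.
  rewrite -/c.
  set F := (nfar _ _)%:R; set q : R := (Q %/ d)%:R => Fq.
  pose x : R := Q%:R / d%:R.
  have qx : q <= x by rewrite ler_pdivlMr// -natrM ler_nat leq_divM.
  have xq : x <= q + 1.
    by rewrite ler_pdivrMr// natr1 -natrM ler_nat ltnW// ltn_ceil.
  have q1 : 1 <= q by rewrite ler1n.
  have -> : (mobius d)%:~R * F - c * Q%:R ^+ 2 * ((mobius d)%:~R / d%:R ^+ 2) =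
      (mobius d)%:~R * (F - c * x ^+ 2).
    by rewrite /x; field; rewrite gt_eqF.
  have -> : 3 * Q%:R * d%:R^-1 = 1 * (3 * x) :> R by rewrite mul1r mulrA.
  rewrite normrM ler_pM//.
    by rewrite -intr_norm lerz1 normr_mobius_le1.
  move: Fq; rewrite !ler_norml => /andP[F1 F2].
  have cq : q ^+ 2 * c <= x ^+ 2 * c by rewrite ler_pM2r// ler_sqr ?nnegrE; lra.
  (* Passing from the floor [q] to the real quotient [x] costs [x] (as [c <= 1 / 4]), which with
     [2 q] from [nfar_approx] makes [3 x]. *)
  have cx : x ^+ 2 * c <= q ^+ 2 * c + x.
    have : x ^+ 2 - q ^+ 2 <= 2 * x by nra.
    by nra.
  by apply/andP; split; nra.
have h0 : 0 <= harmonic_sum Q :> R.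
  by apply: sumr_ge0 => d _; rewrite invr_ge0.
have := odd_mobius_sum_approx Q Q0 (R := R).
set M := odd_mobius_sum Q; set e := 8 / pi ^+ 2 => Me.
have -> : (nfar_coprime Q k)%:R - Q%:R ^+ 2 * c * e =
   ((nfar_coprime Q k)%:R - c * Q%:R ^+ 2 * M) + c * Q%:R ^+ 2 * (M - e) by ring.
apply: le_trans (ler_normD _ _) _.
have -> : 4 * Q%:R * harmonic_sum Q = 3 * Q%:R * harmonic_sum Q + Q%:R * harmonic_sum Q :> R.
  by ring.
rewrite lerD// normrM ger0_norm; last by rewrite mulr_ge0 ?exprn_ge0 ?ltW.
apply: (@le_trans _ _ (4^-1 * Q%:R ^+ 2 * (4 * harmonic_sum Q / Q%:R))).
  by rewrite ler_pM// ?mulr_ge0 ?exprn_ge0 ?(ltW c0)// ler_pM2r// exprn_gt0.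
rewrite le_eqVlt; apply/orP; left; apply/eqP; field; rewrite gt_eqF//.
Qed.

End count.

(** * Odd Farey neighbours *)

Definition frac (a q : int) : rat := a%:~R / q%:~R.

Lemma frac_numq_denq z : frac (numq z) (denq z) = z.
Proof. exact: divq_num_den. Qed.

Lemma lt_fracl a q z : 0 < q -> (frac a q < z) = (a * denq z < numq z * q).
Proof.
move=> q0; rewrite -{1}[z]divq_num_den /frac ltr_pdivrMr ?ltr0z//.
by rewrite mulrAC ltr_pdivlMr ?ltr0z// -!intrM ltr_int.
Qed.

Lemma lt_fracr a q z : 0 < q -> (z < frac a q) = (numq z * q < a * denq z).
Proof.
move=> q0; rewrite -{1}[z]divq_num_den /frac ltr_pdivlMr ?ltr0z//.
by rewrite mulrAC ltr_pdivrMr ?ltr0z// -!intrM ltr_int.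
Qed.

Lemma frac_coprime a q u v : 0 < q -> u * a + v * q = 1 ->
  numq (frac a q) = a /\ denq (frac a q) = q.
Proof.
move=> q0 uv; have cop : coprime `|a| `|q|.
  by rewrite -coprimezE; apply/coprimezP; exists (u, v).
rewrite /frac coprimeq_num// coprimeq_den// gtr0_sg// mul1r gt_eqF//.
by rewrite gtr0_norm.
Qed.

(** The denominator of [z] is a combination of [q] and [e] whose coefficients are the determinants
    of [z] with the two ends, both at least 1. *)
Lemma frac_between a q p e z : 0 < q -> 0 < e -> p * q - a * e = 1 ->
  frac a q < z -> z < frac p e -> q + e <= denq z.
Proof.
move=> q0 e0 det; rewrite lt_fracl// lt_fracr// => lo up.
have -> : denq z = q * (p * denq z - numq z * e) + e * (numq z * q - a * denq z).
  by rewrite -[LHS]mulr1 -det; ring.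
by nia.
Qed.

Lemma farey_frac Q a q : 0 < q -> denq (frac a q) = q ->
  0 <= a <= q -> q <= Q%:Z -> farey Q (frac a q).
Proof.
move=> q0 dq /andP[a0 aq] qQ; split; last by rewrite dq.
apply/andP; split; first by rewrite /frac divr_ge0// ler0z// ltW.
by rewrite /frac ler_pdivrMr ?ltr0z// mul1r ler_int.
Qed.

(** By determinant 1 and [Q < q + e], [p / e] follows [a / q] in the full Farey sequence. If [e] is
    even, the element after [p / e] has odd denominator and is the one sought. *)
Lemma next_farey_odd (Q q e a p : nat) : odd q -> (q <= Q)%N -> (e <= Q)%N ->
  (Q < q + e)%N -> (a < q)%N -> (p * q = a * e + 1)%N ->
  exists y, consecutive (farey_odd Q) (frac a q) y /\
    q%:Z * numq y - a%:Z * denq y = (if odd e then 1%N else (Q + q) %/ e)%N.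
Proof.
move=> oq qQ eQ Qqe aq pq.
have q0 : 0 < q%:Z by lia.
have e0 : 0 < e%:Z by lia.
have det : p%:Z * q%:Z - a%:Z * e%:Z = 1 by lia.
have [na da] : numq (frac a q) = a /\ denq (frac a q) = q.
  by apply: (@frac_coprime _ _ (- e%:Z) p) => //; lia.
have [np dp] : numq (frac p e) = p /\ denq (frac p e) = e.
  by apply: (@frac_coprime _ _ (q%:Z) (- a%:Z)) => //; lia.
have ap : frac a q < frac p e by rewrite lt_fracl// np dp; lia.
have pe : p%:Z <= e%:Z by nia.
have fa : farey_odd Q (frac a q).
  by split; [apply: farey_frac => //; lia | rewrite da].
case: (boolP (odd e)) => oe.
  exists (frac p e); split; last by rewrite np dp; lia.
  split=> //.
    by split; [apply: farey_frac => //; lia | rewrite dp].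
  move=> [z [[_ zQ] _] /andP[az zp]].
  by have := frac_between _ _ _ _ _ q0 e0 det az zp; lia.
set m := ((Q + q) %/ e)%N.
have e0' : (0 < e)%N by lia.
have mlo : (m * e <= Q + q)%N by rewrite leq_divM.
have mup : (Q + q < m.+1 * e)%N by rewrite ltn_ceil.
have m0 : (0 < m)%N by rewrite divn_gt0//; lia.
(* The Farey recurrence: [m] is the largest integer with [m * e - q <= Q]. *)
pose p' : int := m%:Z * p%:Z - a%:Z; pose q' : int := m%:Z * e%:Z - q%:Z.
have q'0 : 0 < q' by rewrite /q'; lia.
have det' : p' * e%:Z - p%:Z * q' = 1.
  by rewrite /p' /q' -det; ring.
have [np' dp'] : numq (frac p' q') = p' /\ denq (frac p' q') = q'.
  by apply: (@frac_coprime _ _ e (- p%:Z)) => //; rewrite -det'; ring.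
have pp' : frac p e < frac p' q' by rewrite lt_fracl// np' dp'; lia.
(* Equality [p = e] would force [e = 1], which is odd. *)
have p'q' : p' <= q'.
  have : p%:Z < e%:Z by nia.
  by nia.
have p'0 : 0 <= p' by nia.
have detm : q%:Z * p' - a%:Z * q' = m%:Z.
  by rewrite /p' /q' -[RHS]mulr1 -det; ring.
have oq' : odd `|q'|%N.
  have -> : q' = (m * e - q)%N by rewrite /q'; lia.
  by rewrite absz_nat oddB ?oddM ?(negbTE oe) ?andbF ?oq//; lia.
exists (frac p' q'); split; last by rewrite np' dp' detm.
split=> //.
- split; last by rewrite dp'.
  by apply: farey_frac => //; [lia | rewrite /q'; lia].
- exact: lt_trans pp'.
(* On either side of [p / e] the denominator of [z] would exceed [Q], by [Q < q + e] and
   [Q < e + q']; at [p / e] itself it is even. *)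
move=> [z [[_ zQ] oz] /andP[az zp]]; case: (ltgtP z (frac p e)) => [zpe|zpe|zpe].
- by have := frac_between _ _ _ _ _ q0 e0 det az zpe; lia.
- have := frac_between _ _ _ _ _ e0 q'0 det' zpe zp; rewrite /q'; lia.
- by move: oz; rewrite zpe dp absz_nat (negbTE oe).
Qed.

Lemma consecutive_uniq (A : set rat) x y y' :
  consecutive A x y -> consecutive A x y' -> y = y'.
Proof.
move=> [_ Ay xy ny] [_ Ay' xy' ny']; case: (ltgtP y y') => // yy'.
- by case: ny'; exists y; rewrite ?xy.
- by case: ny; exists y'; rewrite ?xy'.
Qed.

(** Determinant at least [k] but not at least [k + 1]. For [k = 1] and even [e], the quotient is at
    least 1 because [e <= Q]. *)
Lemma far_next Q k q e : (0 < k)%N -> odd q -> (q <= Q)%N -> (e <= Q)%N ->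
  (Q < q + e)%N ->
  (far Q k q e && ~~ far Q k.+1 q e) =
  ((if odd e then 1%N else (Q + q) %/ e) == k)%N.
Proof.
move=> k0 oq qQ eQ Qqe; rewrite /far oq qQ eQ Qqe /= eqSS.
case: (boolP (odd e)) => oe /=.
  by rewrite !orbF eq_sym; case: eqP => //; lia.
have e0 : (0 < e)%N by lia.
rewrite (gtn_eqF k0) /= -ltnNge -!leq_divRL// -ltn_divLR// ltnS.
case: (eqVneq k 1%N) => [->|_] /=; last by rewrite -eqn_leq eq_sym.
have : (0 < (Q + q) %/ e)%N by rewrite divn_gt0//; lia.
by lia.
Qed.

(** * Bijection between neighbouring fractions and pairs of denominators *)

Definition far_exact Q k (p : nat * nat) : bool :=
  [&& far Q k p.1 p.2, ~~ far Q k.+1 p.1 p.2 & coprime p.1 p.2].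

(** Write [(q, e)] for [p] and [a / q] for [xy.1]. Given [q], the divisibility and [Q - q < e <= Q]
    make [a] and [e] determine each other. *)
Lemma far_exact_pair Q k p : (0 < k)%N -> far_exact Q k p ->
  exists2 xy, farey_odd_pairs Q k xy &
    denq xy.1 = p.1 /\ (p.1%:Z %| numq xy.1 * p.2%:Z + 1)%Z.
Proof.
case: p => q e k0 /and3P[/= f nf cop].
have := f; case/and5P => oq qQ eQ Qqe _.
have q0 : (0 < q)%N by lia.
have [a aq] := Bezoutl e q0; rewrite (eqP cop) addnC => /dvdnP[p pE].
have [y [cons yE]] := next_farey_odd Q q e a p oq qQ eQ Qqe aq (esym pE).
have [na da] : numq (frac a q) = a /\ denq (frac a q) = q.
  by apply: (@frac_coprime _ _ (- e%:Z) p) => //; lia.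
have kE : (if odd e then 1%N else (Q + q) %/ e)%N = k.
  by apply/eqP; rewrite -far_next// f nf.
exists (frac a q, y); last by rewrite /= na da; split=> //; apply/dvdzP; exists p%:Z; lia.
by split=> //=; rewrite na da yE kE.
Qed.

Lemma pair_far_exact Q k xy : (0 < k)%N -> farey_odd_pairs Q k xy ->
  exists2 p, far_exact Q k p &
    denq xy.1 = p.1 /\ (p.1%:Z %| numq xy.1 * p.2%:Z + 1)%Z.
Proof.
case: xy => x y k0 [/= cons kE].
have [[[/andP[x0 x1] dQ] oq] [[/andP[_ y1] _] _] xy _] := cons.
have dE : denq x = `|denq x|%N by rewrite absz_denq.
have nE : numq x = `|numq x|%N by rewrite gez0_abs// numq_ge0.
set q := `|denq x|%N in oq dE *; set a := `|numq x|%N in nE *.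
have q0 : (0 < q)%N by lia.
have qQ : (q <= Q)%N by lia.
have aq : (a < q)%N.
  have : x < frac 1 1 by apply: lt_le_trans xy _.
  by rewrite lt_fracr//; lia.
have cop : coprime q a by rewrite coprime_sym; exact: coprime_num_den.
have [b bq] := Bezoutl a q0; rewrite (eqP cop) => /dvdnP[c cE].
(* The Bezout solution [b < q] is shifted by a multiple of [q] into the window [Q - q < e <= Q]. *)
pose e := (b + q * ((Q - b) %/ q))%N.
have := divn_eq (Q - b) q; have := ltn_pmod (Q - b) q0.
have eE : ((c + a * ((Q - b) %/ q)) * q = a * e + 1)%N.
  by rewrite mulnDl -cE /e; ring.
move: eE; set s := (c + _)%N; clearbody s => eE.
rewrite mulnC => lt_mod divE.
have eQ : (e <= Q)%N by rewrite /e; lia.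
have Qqe : (Q < q + e)%N by rewrite /e; lia.
have xE : x = frac a q by rewrite -nE -dE frac_numq_denq.
have [y' [cons' y'E]] := next_farey_odd Q q e a _ oq qQ eQ Qqe aq eE.
rewrite -xE in cons'; have yy' := consecutive_uniq _ _ _ _ cons cons'.
exists (q, e) => /=; last first.
  by rewrite nE; split=> //; apply/dvdzP; exists s%:Z; lia.
have kE' : (if odd e then 1%N else (Q + q) %/ e)%N = k.
  by apply/eqP; rewrite -eqz_nat -y'E -yy' -kE nE dE.
have := far_next Q k q e k0 oq qQ eQ Qqe; rewrite kE' eqxx => /andP[f nf].
rewrite /far_exact f nf /=; apply/eqP.
have : (gcdn q e %| a * e + 1)%N by rewrite -eE dvdn_mull// dvdn_gcdl.
by rewrite dvdn_addr ?dvdn_mull ?dvdn_gcdr// dvdn1 => /eqP.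
Qed.

Definition far_exact_seq Q k : seq (nat * nat) :=
  [seq p <- [seq (x, y) | x <- index_iota 0 Q.+1, y <- index_iota 0 Q.+1]
    | far_exact Q k p].

Lemma farW Q k x y : (0 < k)%N -> far Q k.+1 x y -> far Q k x y.
Proof.
move=> k0; rewrite /far eqSS (gtn_eqF k0) /=.
case/and5P=> -> -> -> -> /andP[-> ky] /=.
by rewrite (leq_trans _ ky) ?orbT// leq_mul2r leqnSn orbT.
Qed.

Lemma size_far_exact Q k : (0 < k)%N ->
  (size (far_exact_seq Q k) + nfar_coprime Q k.+1 = nfar_coprime Q k)%N.
Proof.
move=> k0; rewrite -sum1_size big_filter big_mkcond big_allpairs -big_split /=.
apply: eq_bigr => x _; rewrite -big_split; apply: eq_bigr => y _.
rewrite /far_exact /=; have := farW Q k x y k0.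
by case: (far Q k x y); case: (far Q k.+1 x y); case: (coprime x y) => // /(_ isT).
Qed.

Lemma mem_far_exact_seq Q k p : (p \in far_exact_seq Q k) = far_exact Q k p.
Proof.
rewrite mem_filter; case: (boolP (far_exact Q k p)) => //; rewrite andTb.
case: p => x y /and3P[/and5P[_ xQ yQ _ _] _ _].
by rewrite allpairs_f ?mem_index_iota.
Qed.

Lemma farey_numq Q x : farey Q x -> x < 1 -> (0 <= numq x < denq x).
Proof.
move=> [/andP[x0 _] _] x1; rewrite numq_ge0 x0 /=.
have : x < frac 1 1 by [].
by rewrite lt_fracr// mulr1 mul1r.
Qed.

(** A choice function for [far_exact_pair] is shown injective on [far_exact_seq], with image the set
    of pairs of fractions. *)
Lemma N_odd_size Q k : (0 < k)%N -> N_odd Q k = size (far_exact_seq Q k).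
Proof.
move=> k0.
have /choice[G GP] (p : nat * nat) : exists xy, far_exact Q k p ->
    farey_odd_pairs Q k xy /\
    denq xy.1 = p.1 /\ (p.1%:Z %| numq xy.1 * p.2%:Z + 1)%Z.
  case: (boolP (far_exact Q k p)) => [/(far_exact_pair _ _ _ k0)[xy ? ?]|_].
    by exists xy.
  by exists (0, 0).
rewrite /N_odd -(size_map G); apply: perm_size; apply: uniq_perm.
- exact: finmap.fset_uniq.
- have seq_uniq : uniq (far_exact_seq Q k).
    by rewrite filter_uniq// allpairs_uniq ?iota_uniq// => -[x y] [x' y'] _ _ [-> ->].
  rewrite map_inj_in_uniq// {seq_uniq}.
  move=> [q e] [q' e']; rewrite !mem_far_exact_seq => pP p'P GE.
  have [_ [d1 n1]] := GP _ pP; have [_ [d2 n2]] := GP _ p'P.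
  rewrite -GE /= in d2 n2; rewrite /= in d1 n1.
  have qq' : q = q' by apply/eqP; rewrite -eqz_nat -d1 -d2.
  rewrite -{}qq' in p'P d2 n2 *; congr pair.
  set a := numq (G (q, e)).1 in n1 n2.
  (* As [a] is prime to [q], [q] divides [e - e'], and both lie among the [q] integers from
     [Q - q + 1] to [Q]. *)
  have : (q%:Z %| a * (e%:Z - e'%:Z))%Z.
    rewrite (_ : _ * _ = (a * e%:Z + 1) - (a * e'%:Z + 1)); last by ring.
    exact: rpredB.
  rewrite mulrC Gauss_dvdzl; last first.
    by rewrite coprimezE -d1 coprime_sym coprime_num_den.
  move: pP p'P => /and3P[/= /and5P[_ qQ eQ Qqe _] _ _] /and3P[/= /and5P[_ _ e'Q Qqe' _] _ _].
  case/dvdzP=> t tE; case: (ltgtP t 0) => t0; [nia | nia |].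
  by rewrite t0 in tE; lia.
move=> [x y]; rewrite in_fset_set; last exact: finite_farey_odd_pairs.
apply/idP/mapP => [|[p]]; rewrite ?inE; last first.
  by rewrite mem_far_exact_seq => /GP[xyP _] ->.
move=> xyP; have [p pP [d1 n1]] := pair_far_exact _ _ _ k0 xyP.
exists p; first by rewrite mem_far_exact_seq.
have [x'yP [d2 n2]] := GP _ pP.
case: (G p) x'yP d2 n2 => x' y' x'yP d2 n2; rewrite /= in d1 n1 d2 n2.
have lt1 u v : farey_odd_pairs Q k (u, v) -> 0 <= numq u < denq u.
  case=> [[[fu _] [[/andP[_ v1] _] _] uv _] _].
  by apply: farey_numq fu _; apply: lt_le_trans v1.
have xx' : x = x'.
  rewrite -[x]frac_numq_denq -[x']frac_numq_denq d1 d2; congr (frac _ _).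
  have := lt1 _ _ xyP; have := lt1 _ _ x'yP; rewrite d1 d2.
  (* The factor [p.2], prime to [p.1], cancels, and both numerators lie between 0 and [p.1 - 1]. *)
  have : (p.1%:Z %| (numq x - numq x') * p.2%:Z)%Z.
    rewrite (_ : _ * _ = (numq x * p.2%:Z + 1) - (numq x' * p.2%:Z + 1)); last by ring.
    exact: rpredB.
  rewrite Gauss_dvdzl; last by case/and3P: pP.
  case/dvdzP=> t tE; case: (ltgtP t 0) => t0; [nia | nia |].
  by rewrite t0 in tE; lia.
rewrite -{}xx' in x'yP *; congr pair.
exact: consecutive_uniq xyP.1 x'yP.1.
Qed.

(** * The asymptotic formula as a difference of two counts *)

Lemma N_odd_nfar Q k : (0 < k)%N ->
  (N_odd Q k + nfar_coprime Q k.+1 = nfar_coprime Q k)%N.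
Proof. by move=> k0; rewrite N_odd_size// size_far_exact. Qed.

(** The main terms telescope: [1 / (k (k + 1)) - 1 / ((k + 1) (k + 2))] is
    [2 / (k (k + 1) (k + 2))]; the two errors add up to the constant 8. *)
Lemma N_odd_approx (R : realType) Q k : (0 < k)%N -> (0 < Q)%N ->
  `|(N_odd Q k)%:R -
    (2 * Q%:R ^+ 2 / pi ^+ 2) * (4 / (k%:R * (k%:R + 1) * (k%:R + 2)))|
  <= 8 * Q%:R * (1 + ln Q%:R) :> R.
Proof.
move=> k0 Q0; have kR : 0 < k%:R :> R by rewrite ltr0n.
have QR : 0 < Q%:R :> R by rewrite ltr0n.
have e1 := nfar_coprime_approx Q k k0 Q0 (R := R).
have e2 := nfar_coprime_approx Q k.+1 isT Q0 (R := R).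
have hQ : 4 * Q%:R * harmonic_sum Q <= 4 * Q%:R * (1 + ln Q%:R) :> R.
  by rewrite ler_pM2l ?mulr_gt0// harmonic_sum_le.
have NE : (N_odd Q k)%:R = (nfar_coprime Q k)%:R - (nfar_coprime Q k.+1)%:R :> R.
  by rewrite -(N_odd_nfar Q k k0) natrD addrK.
have -> : 2 * Q%:R ^+ 2 / pi ^+ 2 * (4 / (k%:R * (k%:R + 1) * (k%:R + 2))) =
    Q%:R ^+ 2 / (2 * k%:R * (k%:R + 1)) * (8 / pi ^+ 2) -
    Q%:R ^+ 2 / (2 * k.+1%:R * (k.+1%:R + 1)) * (8 / pi ^+ 2) :> R.
  have p0 := @pi_gt0 R; rewrite -[k.+1%:R]natr1.
  move: pi p0 k%:R kR Q%:R {QR e1 e2 hQ NE} => p p0 x x0 y.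
  field; rewrite !gt_eqF//; lra.
rewrite NE; set a := _ / _ * _ in e1 *; set b := _ / _ * _ in e2 *.
rewrite (_ : _ - _ = ((nfar_coprime Q k)%:R - a) - ((nfar_coprime Q k.+1)%:R - b)).
  by apply: le_trans (ler_normB _ _) _; lra.
by rewrite !opprB addrACA [RHS]addrACA [- a - _]addrC.
Qed.

Theorem theorem1 (R : realType) (k : nat) (hk : (0 < k)%N) :
  (fun Q : nat => (N_odd Q k)%:R : R) =
  (fun Q : nat => (2 * Q%:R ^+ 2 / pi ^+ 2) * (4 / (k%:R * (k%:R + 1) * (k%:R + 2)))) +O_\oo
  (fun Q : nat => Q%:R * ln Q%:R).
Proof.
(* From [Q = 2] on, [1 <= ln Q / ln 2] absorbs the 1 in [1 + ln Q]; at [Q = 1] the logarithm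
   vanishes. *)
apply/eqaddOP; exists (8 * (1 + (ln 2)^-1)); split; first exact: num_real.
move=> c cP; exists 2%N => // Q /= Q2.
have ln2 : 0 < ln 2 :> R by rewrite ln_gt0// ltr1n.
have lnQ : ln 2 <= ln Q%:R :> R by rewrite ler_ln ?posrE ?ltr0n ?ler_nat//; lia.
have QR : 0 < Q%:R :> R by rewrite ltr0n; lia.
apply: le_trans (N_odd_approx R Q k hk _) _; first by lia.
rewrite ger0_norm ?mulr_ge0//; last by lra.
rewrite -mulrA mulrCA [leRHS]mulrCA ler_pM2l//.
have one : 1 <= (ln 2)^-1 * ln Q%:R :> R by rewrite mulrC ler_pdivlMr ?mul1r.
have : 8 * (1 + (ln 2)^-1) * ln Q%:R <= c * ln Q%:R.
  by rewrite ler_wpM2r// ltW//; lra.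
by lra.
Qed.
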